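(* Let $X$ and $Y$ be proper discrete metric spaces and let $f\colon X\to Y$ be a coarse map. If $f$ is coarsely open, then the induced map of Higson coronas $\nu f\colon\nu X\to\nu Y$ is open.
   Context: A metric space is proper if the closure of each bounded set is compact; discrete means topologically discrete. A map of metric spaces is proper if preimages of bounded sets are bounded. A map $f\colon X\to Y$ is coarse if it is proper and for each $R>0$ there exists $S>0$ such that $d(x,y)\le R$ implies $d(f(x),f(y))\le S$. Let $N(x,R)$ be the closed ball of radius $R$ about $x$. A function $\varphi\colon X\to\mathbb{C}$ is slowly oscillating if for all $R,\epsilon>0$ there is a bounded $B\subset X$ with $\mathrm{diam}(\varphi(N(x,R)\setminus B))\le\epsilon$ for all $x\in X$. $C_h(X)$ is the set of bounded continuous slowly oscillating functions $X\to\mathbb{C}$. The Higson compactification $hX$ is the closure of the image of $X$ under the embedding $x\mapsto(\varphi(x))_{\varphi\in C_h(X)}$ in $\prod_{\varphi\in C_h(X)}\overline{\varphi(X)}$, and the Higson corona is $\nu X=hX\setminus X$. A coarse map $f$ between proper discrete metric spaces extends uniquely to a continuous map $hf\colon hX\to hY$ with $hf(\nu X)\subset\nu Y$, and $\nu f=hf|_{\nu X}\colon\nu X\to\nu Y$. A function $\rho\colon[0,\infty)\to[0,\infty)$ is TI-increasing if it is (not necessarily strictly) increasing and $\lim_{t\to\infty}\rho(t)=\infty$. Each space carries a fixed basepoint ($x_0\in X$, and likewise a basepoint in $Y$). For $A\subset X$ and TI-increasing $\rho$ put $N(A,\rho)=\bigcup_{x\in A}N\big(x,\rho(d(x,x_0))\big)$,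 and similarly in $Y$ with its basepoint. A map $f\colon X\to Y$ between proper metric spaces is coarsely open if for each unbounded $A\subset X$ and each TI-increasing $\rho$ there exists a TI-increasing $\tilde\rho$ such that $N(f(A),\tilde\rho)\subset f(N(A,\rho))$. *)

(* Defs.v *)
From mathcomp Require Import all_boot all_order all_algebra.
From mathcomp Require Import complex.
From mathcomp Require Import all_classical all_reals all_analysis.
Set Implicit Arguments.
Unset Strict Implicit.
Unset Printing Implicit Defensive.
Import Order.TTheory GRing.Theory Num.Theory.
Import numFieldNormedType.Exports.
Local Open Scope classical_set_scope.
Local Open Scope ring_scope.

(* [R[i]] itself has no registered topology; its regular module [R[i]^o] has
   the one induced by the modulus. *)
Notation Cplx R := ((complex R)^o)%type.

(* The modulus [`|z - w|] of MathComp lives in [R[i]]; [cdist z w] is the same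
   number as an element of [R]. *)
Definition cdist (R : realType) (z w : Cplx R) : R :=
  ComplexField.Normc.normc (z - w : complex R).

(* The empty set has diameter [-oo], hence [diam set0 <= e] for every [e]. *)
Definition diam (R : realType) (A : set (Cplx R)) : \bar R :=
  ereal_sup [set (cdist z w)%:E | z in A & w in A].

Section MetricSpaces.
Context {R : realType}.
Implicit Types X Y : metricType R.

Definition mbounded X (A : set X) : Prop :=
  exists r : R, forall x y, A x -> A y -> mdist x y <= r.

Definition proper_space X : Prop :=
  forall A : set X, mbounded A -> compact (closure A).

Definition discrete_space X : Prop := forall A : set X, open A.

Definition proper_map X Y (f : X -> Y) : Prop :=
  forall B : set Y, mbounded B -> mbounded (f @^-1` B).

Definition coarse_map X Y (f : X -> Y) : Prop :=
  proper_map f /\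
  forall r : R, 0 < r -> exists2 s : R, 0 < s &
    forall x y, mdist x y <= r -> mdist (f x) (f y) <= s.

(* The library's [closed_ball] is the closure of the open ball, which may be
   strictly smaller than the set below. *)
Definition cball X (x : X) (r : R) : set X := [set y | mdist x y <= r].

(* Only the values of [rho] on [0, +oo[ matter. *)
Definition TI_increasing (rho : R -> R) : Prop :=
  [/\ forall t, 0 <= t -> 0 <= rho t,
      forall s t, 0 <= s -> s <= t -> rho s <= rho t
    & rho t @[t --> +oo] --> +oo].

Definition rho_nbhd X (x0 : X) (A : set X) (rho : R -> R) : set X :=
  \bigcup_(x in A) cball x (rho (mdist x x0)).

Definition coarsely_open X Y (x0 : X) (y0 : Y) (f : X -> Y) : Prop :=
  forall A : set X, ~ mbounded A ->
  forall rho, TI_increasing rho ->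
  exists2 rho', TI_increasing rho' &
    rho_nbhd y0 (f @` A) rho' `<=` f @` (rho_nbhd x0 A rho).

Definition slowly_oscillating X (phi : X -> Cplx R) : Prop :=
  forall r e : R, 0 < r -> 0 < e ->
  exists2 B : set X, mbounded B &
    forall x, (diam (phi @` (cball x r `\` B)) <= e%:E)%E.

Definition Ch X : set (X -> Cplx R) :=
  [set phi | [/\ bounded_fun phi, continuous phi & slowly_oscillating phi]].

End MetricSpaces.

Arguments Ch {R} X.

Section Higson.
Context {R : realType}.
Implicit Types X Y : metricType R.

Definition Ch_closed_range X (phi : Ch X) : set (Cplx R) :=
  closure (range (val phi)).

Definition higson_product X : topologicalType :=
  prod_topology (fun phi : Ch X => set_type (Ch_closed_range phi)).

Lemma Ch_closed_rangeP X (phi : Ch X) (x : X) :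
  Ch_closed_range phi (val phi x).
Proof. by apply: subset_closure; exists x. Qed.

Definition higson_embed X (x : X) : higson_product X :=
  fun phi => exist _ (val phi x) (mem_set (@Ch_closed_rangeP X phi x)).

Definition higson X : topologicalType :=
  set_type (closure (range (@higson_embed X))).

Lemma higson_inclP X (x : X) :
  closure (range (@higson_embed X)) (higson_embed x).
Proof. by apply: subset_closure; exists x. Qed.

Definition higson_incl X (x : X) : higson X :=
  exist _ (higson_embed x) (mem_set (@higson_inclP X x)).

Definition corona_set X : set (higson X) := ~` range (@higson_incl X).

Definition corona X : topologicalType := set_type (@corona_set X).

Definition is_higson_extension X Y (f : X -> Y) (hf : higson X -> higson Y) :=
  continuous hf /\ forall x, hf (higson_incl x) = higson_incl (f x).

Definition higson_eval X (phi : Ch X) (p : higson X) : Cplx R :=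
  val (val p phi).

Lemma continuous_initial (S : choiceType) (T Z : topologicalType) (i : S -> T)
    (g : Z -> initial_topology i) :
  continuous (fun z => i (g z)) -> continuous g.
Proof.
move=> cg; apply/continuousP => _ [A oA <-].
by move/continuousP: cg => /(_ _ oA).
Qed.

Lemma continuous_prod (I : Type) (T : I -> topologicalType)
    (Z : topologicalType) (g : Z -> prod_topology T) :
  (forall i, continuous (fun z => g z i)) -> continuous g.
Proof.
move=> cg z; apply/cvg_sup => i.
exact: (@continuous_initial _ _ _ (fun h : prod_topology T => h i) g (cg i) z).
Qed.

Lemma prod_eval_continuous (I : Type) (T : I -> topologicalType) (i : I) :
  continuous (fun h : prod_topology T => h i).
Proof.
move=> h; have /cvg_sup/(_ i) hi : h --> h by apply: cvg_id.
move=> A nA; apply: hi.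
exact: (@initial_continuous _ _ (fun h : prod_topology T => h i)).
Qed.

Lemma higson_eval_continuous X (phi : Ch X) : continuous (higson_eval phi).
Proof.
move=> p; rewrite /higson_eval.
apply: (@continuous_comp (higson X) (set_type (Ch_closed_range phi)) (Cplx R)
  (fun p : higson X => val p phi) val); last exact: initial_continuous.
apply: (@continuous_comp (higson X) (higson_product X)
  (set_type (Ch_closed_range phi)) val (fun h => h phi)).
  exact: initial_continuous.
exact: prod_eval_continuous.
Qed.

Lemma higson_evalP X (p q : higson X) :
  (forall phi, higson_eval phi p = higson_eval phi q) -> p = q.
Proof.
move=> pq; apply: val_inj; apply: functional_extensionality_dep => phi.
exact/val_inj/pq.
Qed.

Lemma continuous_higson X (Z : topologicalType) (g : Z -> higson X) :
  (forall phi, continuous (fun z => higson_eval phi (g z))) -> continuous g.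
Proof.
move=> cg; apply: continuous_initial; apply: continuous_prod => phi.
by apply: continuous_initial; exact: cg.
Qed.

Lemma higson_incl_dense X (p : higson X) (U : set (higson X)) :
  nbhs p U -> exists x, U (higson_incl x).
Proof.
move=> [_ [[W oW <-] /= Wp] WU].
have [_ [[x _ <-] Wx]] := set_valP p _ (open_nbhs_nbhs (conj oW Wp)).
by exists x; apply: WU.
Qed.

Lemma Cplx_hausdorff : hausdorff_space (Cplx R).
Proof. exact: norm_hausdorff. Qed.

Lemma higson_hausdorff X : hausdorff_space (higson X).
Proof.
move=> p q pq; apply: higson_evalP => phi; apply: Cplx_hausdorff => A B nA nB.
have [z [zA zB]] := pq _ _ (higson_eval_continuous nA)
  (higson_eval_continuous nB).
by exists (higson_eval phi z).
Qed.

Lemma higson_extension_unique X Y (f : X -> Y) (g h : higson X -> higson Y) :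
  is_higson_extension f g -> is_higson_extension f h -> g = h.
Proof.
move=> [cg gE] [ch hE]; apply/funext => p.
apply: higson_hausdorff => A B nA nB.
have gA : nbhs p (g @^-1` A) := cg p A nA.
have hB : nbhs p (h @^-1` B) := ch p B nB.
have [x [xA xB]] := higson_incl_dense (filterI gA hB).
by exists (higson_incl (f x)); split; [rewrite -gE|rewrite -hE].
Qed.

Lemma discrete_continuous X (T : topologicalType) (f : X -> T) :
  discrete_space X -> continuous f.
Proof. by move=> dX; apply/continuousP => A _; exact: dX. Qed.

Lemma diam_le (A : set (Cplx R)) (e : R) :
  (forall z w, A z -> A w -> cdist z w <= e) -> (diam A <= e%:E)%E.
Proof.
by move=> Ae; apply: ge_ereal_sup => _ [z Az [w Aw <-]]; rewrite lee_fin Ae.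
Qed.

Lemma cdist_le_diam (A : set (Cplx R)) z w :
  A z -> A w -> ((cdist z w)%:E <= diam A)%E.
Proof. by move=> Az Aw; apply: ereal_sup_ubound; exists z => //; exists w. Qed.

Lemma Ch_comp X Y (f : X -> Y) (psi : Ch Y) :
  discrete_space X -> coarse_map f -> Ch X (val psi \o f).
Proof.
move=> dX [fp fc]; have [bpsi _ spsi] := set_valP psi; split.
- by move: bpsi; rewrite /= /bounded_near; apply: filterS => M PM x _; exact: PM.
- exact: discrete_continuous.
- move=> r e r0 e0; have [s s0 fs] := fc _ r0.
  have [B bB Be] := spsi _ _ s0 e0; exists (f @^-1` B); first exact: fp.
  move=> x; apply: diam_le => _ _ [y [yr yB] <-] [z [zr zB] <-].
  rewrite -lee_fin; apply: le_trans (Be (f x)); apply: cdist_le_diam.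
    by exists (f y) => //; split=> //; apply: fs.
  by exists (f z) => //; split=> //; apply: fs.
Qed.

Lemma higson_extension_exists X Y (f : X -> Y) :
  discrete_space X -> coarse_map f ->
  exists hf, is_higson_extension f hf.
Proof.
move=> dX cf.
pose pb (psi : Ch Y) : Ch X :=
  exist _ (val psi \o f) (mem_set (Ch_comp psi dX cf)).
have evP p (psi : Ch Y) : Ch_closed_range psi (higson_eval (pb psi) p).
  have : Ch_closed_range (pb psi) (higson_eval (pb psi) p).
    exact: (set_valP (val p (pb psi))).
  by apply: closureS => _ [x _ <-]; exists (f x).
pose g (p : higson X) : higson_product Y :=
  fun psi => exist _ (higson_eval (pb psi) p) (mem_set (evP p psi)).
have cg : continuous g.
  apply: continuous_prod => psi; apply: continuous_initial => /=.
  exact: higson_eval_continuous.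
have gincl x : g (higson_incl x) = higson_embed (f x).
  by apply: functional_extensionality_dep => psi; exact: val_inj.
have gP p : closure (range (@higson_embed Y)) (g p).
  move=> U /cg /higson_incl_dense[x Ux].
  by exists (higson_embed (f x)); split; [exists (f x)|rewrite -gincl].
exists (fun p => exist _ (g p) (mem_set (gP p))); split.
  exact: continuous_initial.
by move=> x; apply: val_inj; exact: gincl.
Qed.

Lemma Ch_indic Y (y : Y) :
  discrete_space Y -> Ch Y (fun z => (z == y)%:R : Cplx R).
Proof.
move=> dY; split.
- rewrite /= /bounded_near; near=> M => z _ /=; apply: (@le_trans _ _ 1).
    by case: (z == y); rewrite ?normr1 ?normr0.
  by near: M; exact: nbhs_pinfty_ge.
- exact: discrete_continuous.
- move=> r e r0 e0; exists [set y].
    by exists 0 => _ _ -> ->; rewrite mdistxx.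
  move=> x; apply: diam_le => _ _ [z [_ /eqP zy] <-] [w [_ /eqP wy] <-].
  rewrite (negbTE zy) (negbTE wy) /cdist subrr.
  by rewrite ComplexField.Normc.normc0 ltW.
Unshelve. all: by end_near. Qed.

Lemma higson_extension_corona X Y (f : X -> Y) (hf : higson X -> higson Y) :
  proper_space X -> discrete_space X -> discrete_space Y -> coarse_map f ->
  is_higson_extension f hf ->
  forall p, corona_set p -> corona_set (hf p).
Proof.
move=> pX dX dY [fp _] [chf hfE] p Xp [y _ yE]; apply: Xp.
have [psi psiE] : exists psi : Ch Y,
    forall z, higson_eval psi (higson_incl z) = (z == y)%:R.
  by exists (exist _ (fun z => (z == y)%:R) (mem_set (Ch_indic y dY))).
pose F := f @^-1` [set y].
have FC : compact (@higson_incl X @` F).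
  apply: continuous_compact.
    exact/continuous_subspaceT/discrete_continuous.
  have -> : F = closure F.
    by apply/closure_id; rewrite -[F]setCK; exact/open_closedC/dX.
  by apply/pX/fp; exists 0 => _ _ -> ->; rewrite mdistxx.
have Fcl := compact_closed (@higson_hausdorff X) FC.
suff : (@higson_incl X @` F) p by move=> [x _ <-]; exists x.
apply: Fcl => U nU.
pose B : set (Cplx R) := ball (1 : Cplx R) 1.
have psi1 : higson_eval psi (hf p) = 1.
  by rewrite -yE psiE eqxx.
have nB : nbhs (higson_eval psi (hf p)) B.
  by rewrite psi1; exact: nbhsx_ballx.
have nW : nbhs (hf p) (higson_eval psi @^-1` B).
  by have := @higson_eval_continuous Y psi (hf p) B nB; rewrite !nbhs_simpl.
have nV : nbhs p (hf @^-1` (higson_eval psi @^-1` B)).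
  by have := chf p _ nW; rewrite !nbhs_simpl.
have [x [xU]] := higson_incl_dense (filterI nU nV).
rewrite -[X in X -> _]/(B (higson_eval psi (hf _))) hfE.
rewrite psiE => xV.
exists (higson_incl x); split=> //; exists x => //; apply/eqP.
move: xV; case: eqP => // _.
by rewrite /B -ball_normE mulr0n /= subr0 normr1 ltxx.
Qed.

End Higson.

Section InducedMaps.
Context {R : realType} {X Y : metricType R}.
Hypotheses (pX : proper_space X) (dX : discrete_space X).
Hypothesis dY : discrete_space Y.
Context {f : X -> Y}.
Hypothesis cf : coarse_map f.

(* The extension is unique by [higson_extension_unique], so the choice made by
   [cid] is immaterial. *)
Definition higson_map : higson X -> higson Y :=
  sval (cid (higson_extension_exists dX cf)).

Lemma higson_mapP : is_higson_extension f higson_map.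
Proof. exact: svalP (cid (higson_extension_exists dX cf)). Qed.

Lemma higson_map_unique hf : is_higson_extension f hf -> hf = higson_map.
Proof. by move=> ?; apply: higson_extension_unique higson_mapP. Qed.

Lemma corona_mapP (p : corona X) : corona_set (higson_map (val p)).
Proof.
exact: higson_extension_corona pX dX dY cf higson_mapP _ (set_valP p).
Qed.

Definition corona_map (p : corona X) : corona Y :=
  exist _ (higson_map (val p)) (mem_set (@corona_mapP p)).

End InducedMaps.

Definition open_map (S T : topologicalType) (g : S -> T) : Prop :=
  forall U : set S, open U -> open (g @` U).

(* Main.v *)
Require Import Defs.
From mathcomp Require Import all_boot all_order all_algebra.
From mathcomp Require Import complex.
From mathcomp Require Import all_classical all_reals all_analysis.
From mathcomp Require Import ring.
Set Implicit Arguments.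
Unset Strict Implicit.
Unset Printing Implicit Defensive.
Import Order.TTheory GRing.Theory Num.Theory.
Import numFieldNormedType.Exports.
Local Open Scope classical_set_scope.
Local Open Scope ring_scope.

(** Let [p] be a point of the corona of [X] and [U] a neighbourhood of [p] in the
    Higson compactification, which is compact Hausdorff, hence regular. Choose
    open neighbourhoods [W] and [U1] of [p], the closure of [W] lying in [U1] and
    that of [U1] in [U], and let [A] and [D] be the traces of [W] and [U1] on [X].

    The passage from [A] to [D] leaves room at infinity ([bounded_leaving]): two
    nets of [X] that go to infinity at bounded distance from each other have the
    same limits in the corona, because slowly oscillating functions cannot tell
    them apart; so for each [r] only a bounded part of [A] can have points
    outside [D] within distance [r]. Letting [r] grow slowly with the distance
    to the basepoint gives a TI-increasing [rho] for which the [rho]-neighbourhood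
    of [A] is contained in [D] ([TI_radius]).

    Coarse openness turns this into an inclusion N(f(A), rho') in f(D) in [Y]. A
    set is separated at infinity from the complement C of its rho'-neighbourhood:
    the function d(y, f(A)) / (d(y, f(A)) + d(y, C)) is slowly oscillating since
    its denominator tends to infinity ([Ch_separate]). It vanishes on f(A), hence
    at the image of [p], so it is of modulus less than 1 on a neighbourhood of
    that image; every corona point of this neighbourhood is a limit of points of
    f(D), and by compactness the image of a limit [p'] of points of [D]. Thus [p']
    lies in [U]; it lies in the corona because points of [X] are mapped to points
    of [Y]. *)

Section HigsonCorona.
Context {R : realType}.

(** * Compactness of the Higson compactification *)

Lemma cvg_initial (S : choiceType) (T : topologicalType) (i : S -> T)
    (F : set_system S) (s : S) :
  Filter F -> i x @[x --> F] --> i s -> F --> (s : initial_topology i).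
Proof.
move=> FF Fs A [_ [[B oB <-] Bs] BA].
apply: (filterS BA); apply: Fs; exact: open_nbhs_nbhs.
Qed.

Lemma compact_set_type (T : topologicalType) (A : set T) :
  compact A -> compact [set: set_type A].
Proof.
move=> cA F FF _.
have [a [Aa Fa]] : A `&` cluster (val x @[x --> F]) !=set0.
  apply: cA; apply: (@filterS _ F _ setT); last exact: filterT.
  by move=> x _; exact: set_valP.
exists (exist _ a (mem_set Aa)); split=> // B C FB [_ [[V oV <-] Va] VC].
have [_ [[x Bx <-] Vx]] : (@set_val _ A @` B) `&` V !=set0.
  apply: Fa; last exact: open_nbhs_nbhs.
  by apply: (@filterS _ F _ B) => // x Bx; exists x.
by exists x; split=> //; exact: VC.
Qed.

Lemma sqrt_sqrD_le (u v : R) :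
  Num.sqrt (u ^+ 2 + v ^+ 2) <= `|u| + `|v|.
Proof.
rewrite -(ger0_norm (addr_ge0 (normr_ge0 u) (normr_ge0 v))) -sqrtr_sqr.
rewrite ler_wsqrtr // sqrrD !real_normK ?num_real // lerD2r lerDl.
by rewrite mulrn_wge0 // mulr_ge0.
Qed.

Lemma complex_pair_continuous :
  continuous ((fun p => Complex p.1 p.2) : R * R -> Cplx R).
Proof.
move=> [a b]; apply: (iffRL (@cvgrPdist_lt _ _ _ _ _ _ _)) => e.
rewrite ltcE /= => /andP[/eqP e_im e_re].
have e2 : 0 < complex.Re e / 2 by rewrite divr_gt0 ?ltr0n.
exists (ball a (complex.Re e / 2), ball b (complex.Re e / 2)).
  by split; exact: nbhsx_ballx.
move=> [x y] [/= ax bY].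
rewrite normc_def ltcE /= e_im eqxx /=.
have {ax} ax : `|a - x| < complex.Re e / 2 by exact: ax.
have {bY} bY : `|b - y| < complex.Re e / 2 by exact: bY.
apply: (@le_lt_trans _ _ (`|a - x| + `|b - y|)).
  exact: sqrt_sqrD_le.
by rewrite [complex.Re e]splitr ltrD.
Qed.

Lemma Re_normc_le (z : R[i]) : `|complex.Re z| <= ComplexField.Normc.normc z.
Proof. by case: z => a b; rewrite /= -sqrtr_sqr ler_wsqrtr// lerDl sqr_ge0. Qed.

Lemma Im_normc_le (z : R[i]) : `|complex.Im z| <= ComplexField.Normc.normc z.
Proof. by case: z => a b; rewrite /= -sqrtr_sqr ler_wsqrtr// lerDr sqr_ge0. Qed.

(** The square of side [2 * M] centred at the origin is the continuous image of a
    product of two segments. *)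
Lemma bounded_complex_compact (A : set (Cplx R)) (M : R) : closed A ->
  (forall z, A z -> ComplexField.Normc.normc z <= M) -> compact A.
Proof.
move=> cA AM.
pose Q : set (R * R) := `[- M, M] `*` `[- M, M].
have cQ : compact Q by apply: compact_setX; exact: segment_compact.
apply: (subclosed_compact cA
  (continuous_compact (continuous_subspaceT complex_pair_continuous) cQ)).
move=> [a b] /AM abM; exists (a, b) => //; split; rewrite /= in_itv /= -ler_norml.
  exact: le_trans (Re_normc_le (Complex a b)) abM.
exact: le_trans (Im_normc_le (Complex a b)) abM.
Qed.

(** Tychonoff: each factor of the product is the closure of a bounded set of
    complex numbers. *)
Lemma higson_compact (X : metricType R) : compact [set: higson X].
Proof.
apply: compact_set_type.
apply: (@subclosed_compact _ _ setT) => //; first exact: closed_closure.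
have : compact [set g : higson_product X |
    forall phi, [set: set_type (Ch_closed_range phi)] (g phi)].
  apply: (@tychonoff (Ch X) _ (fun=> setT)) => phi; apply: compact_set_type.
  have [bphi _ _] := set_valP phi.
  have [M bM] := @filter_ex R[i] (pinfty_nbhs R[i]) _ _ bphi.
  (* The bound M on the values becomes M + 1 on their closure: each limit point
     is at distance less than 1 from a value. *)
  apply: (@bounded_complex_compact _ (complex.Re M + 1)).
    exact: closed_closure.
  move=> z /(_ _ (nbhsx_ballx z 1 ltr01))[_ [[x _ <-]]].
  rewrite -ball_normE /= ltcR => zx.
  have := bM x I; rewrite /= lecE /= => /andP[_ xM].
  rewrite -[z](subrK (val phi x)) addrC; apply: (le_trans (le_normcD _ _)).
  by apply: lerD => //; apply: ltW.
by congr compact; apply/seteqP; split.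
Qed.

(** * Bounded sets, ultrafilters and the corona *)

Lemma mboundedP (X : metricType R) (x0 : X) (A : set X) :
  mbounded A <-> exists t, forall x, A x -> mdist x x0 <= t.
Proof.
split=> [[r Ar]|[t At]].
  have [->|/set0P[a Aa]] := eqVneq A set0; first by exists 0 => ? [].
  exists (r + mdist a x0) => x Ax; apply: (le_trans (metric_triangle x a x0)).
  by rewrite lerD2r Ar.
exists (t + t) => x y Ax Ay; apply: (le_trans (metric_triangle x x0 y)).
by rewrite lerD ?At // metric_sym At.
Qed.

Lemma mboundedS (X : metricType R) (A B : set X) :
  A `<=` B -> mbounded B -> mbounded A.
Proof. by move=> AB [r Br]; exists r => x y /AB Bx /AB; exact: Br. Qed.

Lemma mboundedU (X : metricType R) (A B : set X) :
  mbounded A -> mbounded B -> mbounded (A `|` B).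
Proof.
have [->|/set0P[a Aa]] := eqVneq A set0; first by rewrite set0U.
move=> /(mboundedP a)[s As] /(mboundedP a)[t Bt].
apply/(mboundedP a); exists (Num.max s t) => x [/As|/Bt] xle.
  by rewrite le_max xle.
by rewrite le_max xle orbT.
Qed.

Lemma mbounded_enlarge (X : metricType R) (B : set X) (g : X -> X) (r : R) :
  (forall x, mdist x (g x) <= r) -> mbounded B -> mbounded (g @^-1` B).
Proof.
move=> gr; have [->|/set0P[b Bb]] := eqVneq B set0; first by exists 0 => ? ? [].
move=> /(mboundedP b)[t Bt]; apply/(mboundedP b); exists (r + t) => x /Bt xt.
by apply: (le_trans (metric_triangle x (g x) b)); rewrite lerD.
Qed.

Lemma higson_cvg (X : metricType R) (T : Type) (F : set_system T)
    (g : T -> higson X) (p : higson X) : Filter F ->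
  (forall phi, higson_eval phi (g t) @[t --> F] --> higson_eval phi p) ->
  g t @[t --> F] --> p.
Proof.
move=> FF gp; apply: cvg_initial; apply/cvg_sup => phi.
by apply: cvg_initial; apply: cvg_initial; exact: gp.
Qed.

(** Along a filter that leaves every bounded set, [phi x - phi (g x)] tends to 0
    for each slowly oscillating [phi], since [x] and [g x] stay at distance at
    most [r]. *)
Lemma higson_cvg_close (X : metricType R) (F : set_system X) (g : X -> X)
    (r : R) (z : higson X) : Filter F -> 0 < r ->
  (forall x, mdist x (g x) <= r) -> (forall B, mbounded B -> F (~` B)) ->
  higson_incl x @[x --> F] --> z -> higson_incl (g x) @[x --> F] --> z.
Proof.
move=> FF r0 gr Fb Fz; apply: higson_cvg => phi.
have phiz : higson_eval phi (higson_incl x) @[x --> F] --> higson_eval phi z.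
  by apply: cvg_comp Fz _; exact: higson_eval_continuous.
have [_ _ so] := set_valP phi.
suff d0 : val phi x - val phi (g x) @[x --> F] --> (0 : Cplx R).
  rewrite -[higson_eval phi z]subr0.
  have -> : (fun t => higson_eval phi (higson_incl (g t)))
     = (fun x => val phi x - (val phi x - val phi (g x))).
    by apply/funext => x; rewrite opprB addrC subrK.
  exact: cvgB phiz d0.
apply: (iffRL (@cvgr0Pnorm_le _ _ _ _ _ _)) => e.
rewrite ltcE /= => /andP[/eqP e_im e_re].
have [B bB Be] := so _ _ r0 e_re.
have := Fb _ (mboundedU bB (mbounded_enlarge gr bB)).
apply: filterS => x /not_orP[nB ngB].
rewrite lecE /= e_im eqxx /= -lee_fin.
apply: le_trans (Be x); apply: cdist_le_diam.
  by exists x => //; split=> //; rewrite /cball /= mdistxx ltW.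
by exists (g x) => //; split=> //; exact: gr.
Qed.

(** In a proper discrete space a bounded set is closed, hence compact. *)
Lemma closed_incl_bounded (X : metricType R) (B : set X) :
  proper_space X -> discrete_space X -> mbounded B ->
  closed (@higson_incl R X @` B).
Proof.
move=> pX dX bB; apply: (compact_closed (@higson_hausdorff R X)).
apply: continuous_compact.
  exact/continuous_subspaceT/discrete_continuous.
have -> : B = closure B; last exact: pX.
by apply/closure_id; rewrite -[B]setCK; exact/open_closedC/dX.
Qed.

Lemma closure_incl (X : metricType R) (p : higson X) (V : set (higson X)) :
  nbhs p V -> closure (@higson_incl R X @` (@higson_incl R X @^-1` V)) p.
Proof.
move=> nV U nU; have [x [Vx Ux]] := higson_incl_dense (filterI nV nU).
by exists (higson_incl x); split=> //; exists x.
Qed.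

(** The closure of a bounded set of [X] adds no point of the corona. *)
Lemma corona_unbounded (X : metricType R) (p : higson X) (A : set X) :
  proper_space X -> discrete_space X -> corona_set p ->
  closure (@higson_incl R X @` A) p -> ~ mbounded A.
Proof.
move=> pX dX Xp Ap bA; apply: Xp.
by have [x _ <-] := closed_incl_bounded pX dX bA Ap; exists x.
Qed.

(** Regularity in a form that gives nested neighbourhoods, to be applied twice. *)
Lemma higson_regular (X : metricType R) (p : higson X) (U : set (higson X)) :
  nbhs p U -> exists V, [/\ open V, V p & closure V `<=` U].
Proof.
move=> nU.
have [V nV VU] := compact_regular (@higson_hausdorff R X) (@higson_compact X)
  (filterT : nbhs p setT) nU.
exists V°; split; first exact: open_interior.
  exact: nV.
by apply: subset_trans VU; apply: closureS; exact: interior_subset.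
Qed.

(** The sets containing [S] up to a bounded part form a proper filter. *)
Lemma unbounded_ultra (X : metricType R) (S : set X) : ~ mbounded S ->
  exists G : set_system X, [/\ UltraFilter G, G S &
    forall B, mbounded B -> G (~` B)].
Proof.
move=> uS.
pose F := filter_from [set B : set X | mbounded B] (fun B => S `\` B).
have FF : ProperFilter F.
  apply: filter_from_proper.
    apply: filter_from_filter; first by exists set0; exists 0 => ? ? [].
    move=> B C bB bC; exists (B `|` C); first exact: mboundedU.
    by move=> x [Sx /not_orP[nB nC]].
  move=> B bB; apply/set0P/eqP => SB; apply: uS; apply: mboundedS bB.
  by rewrite -setD_eq0.
have [G [UG FG]] := ultraFilterLemma FF; exists G; split=> //.
  by apply: FG; exists set0; [exists 0 => ? ? []|move=> x []].
by move=> B bB; apply: FG; exists B => // x [].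
Qed.

(** The push-forward of an ultrafilter is an ultrafilter, so each of its cluster
    points is a limit. *)
Lemma higson_ultra_cvg (X : metricType R) (G : set_system X) :
  UltraFilter G -> exists z, higson_incl x @[x --> G] --> (z : higson X).
Proof.
move=> UG.
have [z [_ zG]] := @higson_compact X (higson_incl x @[x --> G]) _ filterT.
exists z => V nV.
have [//|GV] := in_ultra_setVsetC (@higson_incl R X @^-1` V) UG.
by have [q [nVq Vq]] := zG (~` V) V GV nV.
Qed.

(** If infinitely far points [x] of [W] had partners [g x] outside [U] at distance
    at most [r], both families would have a common limit; it would lie in the
    closure of [W], hence in the open set [U], which the points [g x] avoid. *)
Lemma bounded_leaving (X : metricType R) (W U : set (higson X)) (r : R) :
  open U -> closure W `<=` U -> 0 < r ->
  mbounded [set x | W (higson_incl x) /\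
                    ~ cball x r `<=` @higson_incl R X @^-1` U].
Proof.
move=> oU WU r0; set S := [set x | _]; apply: contrapT => uS.
have /choice[g gP] x : exists y, mdist x y <= r /\
    (S x -> ~ U (higson_incl y)).
  have [[_ /existsNP[y /not_implyP[xy nUy]]]|nS] := pselect (S x).
    by exists y.
  by exists x; rewrite mdistxx ltW.
have [G [UG GS Gb]] := unbounded_ultra uS.
have [z Gz] := higson_ultra_cvg UG.
have Ggz : higson_incl (g x) @[x --> G] --> z.
  by apply: higson_cvg_close r0 _ Gb Gz => x; have [] := gP x.
have Wz : closure W z.
  move=> V nV.
  have [x [[Wx _] Vx]] :=
    @filter_ex _ G _ _ (@filterI _ G _ _ _ GS (Gz _ nV)).
  by exists (higson_incl x).
have nU : nbhs z U by apply: open_nbhs_nbhs; split=> //; exact: WU.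
have [x [Sx Ux]] := @filter_ex _ G _ _ (@filterI _ G _ _ _ GS (Ggz _ nU)).
by have [_ /(_ Sx)] := gP x.
Qed.

(** * From bounded radii to a TI-increasing radius *)

(** At distance [t] the largest admissible radius is the supremum of the set
    [E t] below, which grows with [t]. The condition bears on all points of [A] at
    distance at least [t], which makes this radius monotone, and the bound
    [r <= t] keeps it finite when [D] is everything. *)
Lemma TI_radius (X : metricType R) (x0 : X) (A D : set X) :
  A `<=` D ->
  (forall r, 0 < r -> mbounded [set x | A x /\ ~ cball x r `<=` D]) ->
  exists2 rho, TI_increasing rho & rho_nbhd x0 A rho `<=` D.
Proof.
move=> AD Abd.
pose E t : set R := [set r | [/\ 0 <= r, r <= t &
  forall x, A x -> t <= mdist x x0 -> cball x r `<=` D]].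
have E0 t : 0 <= t -> E t 0.
  move=> t0; split=> // x Ax _ y; rewrite /cball /= => xy.
  suff <- : x = y by exact: AD.
  by apply: mdist_positivity; apply/eqP; rewrite eq_le xy mdist_ge0.
have ubE t : has_ubound (E t) by exists t => r [].
have supE t : 0 <= t -> 0 <= sup (E t).
  by move=> t0; apply: ub_le_sup => //; exact: E0.
(* Halving leaves a radius below some element of [E t] when the supremum is not
   attained. *)
exists (fun t => sup (E t) / 2).
  split.
  - by move=> t t0; rewrite divr_ge0 ?supE.
  - move=> s t s0 st; rewrite ler_pM2r ?invr_gt0 ?ltr0n//.
    apply: ge_sup; first by exists 0; exact: E0.
    move=> r [r0 rs rP]; apply: ub_le_sup => //; split=> //.
      exact: le_trans st.
    by move=> x Ax tx; apply: rP => //; exact: le_trans tx.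
  - apply/cvgryPge => M.
    pose r := 2 * Num.max M 1.
    have r0 : 0 < r by rewrite mulr_gt0 ?ltr0n // lt_max ltr01 orbT.
    have /(mboundedP x0)[T Tb] := Abd _ r0.
    near=> t.
    have rt : r <= t by near: t; apply: nbhs_pinfty_ge; exact: num_real.
    have Tt : T < t by near: t; apply: nbhs_pinfty_gt; exact: num_real.
    apply: (@le_trans _ _ (Num.max M 1)); first by rewrite le_max lexx.
    rewrite ler_pdivlMr ?ltr0n // mulrC; apply: ub_le_sup => //; split=> //.
      exact: ltW.
    move=> x Ax tx; apply: contrapT => nD.
    by have := Tb x (conj Ax nD); rewrite leNgt (lt_le_trans Tt tx).
move=> y [x Ax xy]; set t := mdist x x0 in xy.
have t0 : 0 <= t by exact: mdist_ge0.
have hs : has_sup (E t) by split=> //; exists 0; exact: E0.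
have [s0|s0] := leP (sup (E t)) 0.
  have [_ _ /(_ x Ax (lexx _))] := E0 _ t0.
  by apply; apply: (le_trans xy); rewrite pmulr_lle0 // invr_gt0 ltr0n.
have [r [_ _ /(_ x Ax (lexx _))]] := sup_adherent (divr_gt0 s0 (ltr0n _ 2)) hs.
move=> rD lr; apply: rD; apply: (le_trans xy); apply: ltW.
by rewrite [X in X - _](splitr (sup (E t))) addrK in lr.
Unshelve. all: by end_near. Qed.

(** * Slowly oscillating functions that separate sets at infinity *)

Definition dist_to (X : metricType R) (E : set X) (y : X) : R :=
  inf [set mdist y a | a in E].

Lemma dist_to_le (X : metricType R) (E : set X) (y a : X) :
  E a -> dist_to E y <= mdist y a.
Proof.
move=> Ea; apply: ge_inf; last by exists a.
by exists 0 => _ [b _ <-]; exact: mdist_ge0.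
Qed.

Lemma dist_to_ge0 (X : metricType R) (E : set X) (y : X) :
  E !=set0 -> 0 <= dist_to E y.
Proof.
move=> [a Ea]; apply: lb_le_inf; first by exists (mdist y a); exists a.
by move=> _ [b _ <-]; exact: mdist_ge0.
Qed.

Lemma dist_to_lip (X : metricType R) (E : set X) (y z : X) :
  E !=set0 -> dist_to E y <= dist_to E z + mdist y z.
Proof.
move=> [a Ea]; rewrite -lerBlDr; apply: lb_le_inf.
  by exists (mdist z a); exists a.
move=> _ [b Eb <-]; rewrite lerBlDr addrC.
exact: le_trans (dist_to_le y Eb) (metric_triangle y z b).
Qed.

Lemma dist_to_lt (X : metricType R) (E : set X) (y : X) (t : R) :
  E !=set0 -> dist_to E y < t -> exists2 a, E a & mdist y a < t.
Proof.
move=> [a Ea] yt; apply: contrapT => nE.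
move: yt; rewrite ltNge => /negP; apply; apply: lb_le_inf.
  by exists (mdist y a); exists a.
by move=> _ [b Eb <-]; rewrite leNgt; apply/negP => bt; apply: nE; exists b.
Qed.

(** The difference of the quotients has numerator [u * (v' - v) + v * (u - u')],
    of size at most [(u + v) * e], and the factor [u + v] cancels. *)
Lemma ratio_lip (u v u' v' e : R) :
  0 <= u -> 0 <= v -> 0 < u + v -> 0 < u' + v' ->
  `|u - u'| <= e -> `|v - v'| <= e ->
  `|u / (u + v) - u' / (u' + v')| <= e / (u' + v').
Proof.
move=> u0 v0 s0 s'0 ue ve.
have -> : u / (u + v) - u' / (u' + v') =
    (u * (v' - v) + v * (u - u')) / ((u + v) * (u' + v')).
  by field; rewrite !gt_eqF.
rewrite normrM [`|_^-1|]gtr0_norm ?invr_gt0 ?mulr_gt0 //.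
rewrite ler_pdivrMr ?mulr_gt0 //.
have -> : e / (u' + v') * ((u + v) * (u' + v')) = u * e + v * e.
  by field; rewrite gt_eqF.
apply: (le_trans (ler_normD _ _)); rewrite !normrM (ger0_norm u0) (ger0_norm v0).
by rewrite lerD // ler_wpM2l // distrC.
Qed.

(** By [ratio_lip] the oscillation of the quotient over a ball of radius [r] is at
    most [2 * r] divided by a value of [u + v], which is large outside a bounded
    set. *)
Lemma Ch_ratio (Y : metricType R) (u v : Y -> R) : discrete_space Y ->
  (forall y, 0 <= u y) -> (forall y, 0 <= v y) ->
  (forall y z, u y <= u z + mdist y z) -> (forall y z, v y <= v z + mdist y z) ->
  (forall M, mbounded [set y | u y + v y < M]) ->
  Ch Y (fun y => Complex (u y / (u y + v y)) 0 : Cplx R).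
Proof.
move=> dY u0 v0 ul vl uvM.
have lip (w : Y -> R) (x y z : Y) (r : R) :
    (forall y z, w y <= w z + mdist y z) ->
    cball x r y -> cball x r z -> `|w y - w z| <= 2 * r.
  rewrite /cball /= => wl xy xz.
  have yz : mdist y z <= 2 * r.
    rewrite mulr_natl mulr2n; apply: (le_trans (metric_triangle y x z)).
    by rewrite lerD // metric_sym.
  rewrite ler_distlC; apply/andP; split.
    by rewrite lerBlDr (le_trans (wl y z)) // lerD2l.
  by rewrite (le_trans (wl z y)) // lerD2l metric_sym.
split.
- (* The quotient is at most 1; where [u + v] vanishes it is [0 / 0 = 0]. *)
  rewrite /= /bounded_near; near=> M => z _ /=; apply: (@le_trans _ _ 1).
    rewrite normc_def /= expr0n addr0 sqrtr_sqr lecE /= eqxx /=.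
    have s0 : 0 <= u z + v z by rewrite addr_ge0.
    rewrite ger0_norm ?divr_ge0 //; have [->|sN0] := eqVneq (u z + v z) 0.
      by rewrite invr0 mulr0.
    by rewrite ler_pdivrMr ?mul1r ?lerDl // lt_neqAle eq_sym sN0.
  by near: M; exact: nbhs_pinfty_ge.
- exact: discrete_continuous.
- move=> r e r0 e0.
  (* The threshold for which [2 * r / M = e]. *)
  pose M := 2 * r / e.
  have M0 : 0 < M by rewrite !mulr_gt0 ?invr_gt0 ?ltr0n.
  exists [set y | u y + v y < M]; first exact: uvM.
  move=> x; apply: diam_le => _ _ [y [xy /negP yM] <-] [z [xz /negP zM] <-].
  rewrite -leNgt in yM; rewrite -leNgt in zM.
  rewrite /cdist /= subrr expr0n addr0 sqrtr_sqr.
  have s0 := lt_le_trans M0 yM; have s'0 := lt_le_trans M0 zM.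
  apply: (le_trans (ratio_lip (u0 y) (v0 y) s0 s'0 (lip _ _ _ _ _ ul xy xz)
    (lip _ _ _ _ _ vl xy xz))).
  by rewrite ler_pdivrMr // [e * _]mulrC -ler_pdivrMr.
Unshelve. all: by end_near. Qed.

(** A point [y] close to both [E] and [C] would bring a point [a] of [E] within
    [2 * M] of [C]; if [y] is far from the basepoint so is [a], and then the ball
    of radius [rho] about [a], which misses [C], has radius at least [2 * M]. *)
Lemma dist_sum_proper (Y : metricType R) (y0 : Y) (E : set Y) (rho : R -> R)
    (C := ~` rho_nbhd y0 E rho) :
  TI_increasing rho -> E !=set0 -> C !=set0 ->
  forall M, mbounded [set y | dist_to E y + dist_to C y < M].
Proof.
move=> [_ _ rhoy] E0 C0 M.
have [T [_ rhoT]] := (iffLR (cvgryPge rho) rhoy) (M + M).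
apply/(mboundedP y0); exists (T + M) => y /= yM; rewrite leNgt; apply/negP => yT.
have [a Ea ya] : exists2 a, E a & mdist y a < M.
  by apply: dist_to_lt => //; apply: le_lt_trans yM; rewrite lerDl dist_to_ge0.
have [c Cc yc] : exists2 c, C c & mdist y c < M.
  by apply: dist_to_lt => //; apply: le_lt_trans yM; rewrite lerDr dist_to_ge0.
apply: Cc; exists a => //; rewrite /cball /=.
apply: (le_trans (metric_triangle a y c)); rewrite metric_sym.
apply: (@le_trans _ _ (M + M)); first by rewrite lerD // ltW.
apply: rhoT; rewrite -(ltrD2r M) (lt_le_trans yT) //.
by apply: (le_trans (metric_triangle y a y0)); rewrite addrC lerD2l ltW.
Qed.

(** With [C] the complement of the neighbourhood, the function is
    [dist_to E / (dist_to E + dist_to C)]. It equals 1 on [C] wherever the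
    denominator is not 0, which holds outside a bounded set. *)
Lemma Ch_separate (Y : metricType R) (y0 : Y) (E : set Y) (rho : R -> R) :
  discrete_space Y -> TI_increasing rho -> E !=set0 ->
  exists psi : Ch Y, (forall y, E y -> val psi y = 0) /\
    mbounded [set y | `|val psi y| < 1 /\ ~ rho_nbhd y0 E rho y].
Proof.
move=> dY rhoTI E0; pose C := ~` rho_nbhd y0 E rho.
have [C0|/set0P C0] := eqVneq C set0.
  (* The infimum over the empty [C] would be 0, which does not tend to infinity:
     the zero function does instead, written as a quotient to reuse [Ch_ratio]. *)
  have Ch0 : Ch Y (fun y => Complex (0 / (0 + mdist y y0)) 0 : Cplx R).
    apply: (@Ch_ratio _ (fun=> 0) (fun y => mdist y y0)) => //.
    - by move=> y; exact: mdist_ge0.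
    - by move=> y z; rewrite add0r mdist_ge0.
    - by move=> y z; rewrite addrC; exact: metric_triangle.
    - by move=> M; apply/(mboundedP y0); exists M => y /=; rewrite add0r => /ltW.
  exists (exist (fun phi => phi \in Ch Y) _ (mem_set Ch0)); split.
    by move=> y _ /=; rewrite mul0r.
  by exists 0 => y z [_]; rewrite -[~ _]/(C y) C0.
have Chr := Ch_ratio dY (fun y => dist_to_ge0 y E0) (fun y => dist_to_ge0 y C0)
  (fun y z => dist_to_lip y z E0) (fun y z => dist_to_lip y z C0)
  (dist_sum_proper rhoTI E0 C0).
exists (exist (fun phi => phi \in Ch Y) _ (mem_set Chr)); split=> [y Ey|] /=.
  suff -> : dist_to E y = 0 by rewrite mul0r.
  by apply/eqP; rewrite eq_le dist_to_ge0 // -(mdistxx y) dist_to_le.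
apply: mboundedS (dist_sum_proper rhoTI E0 C0 1) => y [psi1 Cy] /=.
rewrite ltNge; apply/negP => s1; move: psi1.
have v0 : dist_to C y = 0.
  by apply/eqP; rewrite eq_le dist_to_ge0 // -[in leRHS](mdistxx y) dist_to_le.
rewrite -/C v0 addr0 in s1 *; rewrite divff.
  by rewrite normr1 ltxx.
by rewrite gt_eqF // (lt_le_trans ltr01).
Qed.

(** * Openness of the extension along the corona *)

(** The set [V] is the locus where the separating function has modulus less than
    1, deprived of the bounded set on which that function does not control
    membership in the neighbourhood of [f @` A]. *)
Lemma higson_extension_open (X Y : metricType R) (x0 : X) (y0 : Y) (f : X -> Y)
    (hf : higson X -> higson Y) :
  proper_space X -> discrete_space X -> proper_space Y -> discrete_space Y ->
  coarse_map f -> coarsely_open x0 y0 f -> is_higson_extension f hf ->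
  forall p (U : set (higson X)), corona_set p -> nbhs p U ->
  exists V, [/\ open V, V (hf p) & V `&` @corona_set R Y `<=` hf @` U].
Proof.
move=> pX dX pY dY cf fo [chf hfE] p U Xp nU.
have [U1 [oU1 U1p U1U]] := higson_regular nU.
have [W [oW Wp WU1]] := higson_regular (open_nbhs_nbhs (conj oU1 U1p)).
pose A := @higson_incl R X @^-1` W; pose D := @higson_incl R X @^-1` U1.
have AD : A `<=` D by move=> x Ax; apply/WU1/subset_closure.
have [rho rhoTI rhoD] :=
  TI_radius x0 AD (fun r r0 => bounded_leaving oU1 WU1 r0).
have Ap : closure (@higson_incl R X @` A) p.
  by apply: closure_incl; exact: open_nbhs_nbhs.
have uA := corona_unbounded pX dX Xp Ap.
have A0 : A !=set0.
  by apply/set0P/eqP => A0; apply: uA; rewrite A0; exists 0 => ? ? [].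
have [rho' rho'TI rho'f] := fo A uA rho rhoTI.
have [psi [psi0 psib]] : exists psi : Ch Y, _ :=
  Ch_separate y0 dY rho'TI (image_nonempty f A0).
set N := rho_nbhd y0 _ rho' in psib; set B := [set y | _] in psib.
pose V := (higson_eval psi @^-1` ball (0 : Cplx R) 1) `&`
          ~` (@higson_incl R Y @` B).
have oV : open V.
  apply: openI; last exact/closed_openC/closed_incl_bounded.
  apply: open_comp; last exact: ball_open.
  by move=> q _; exact: higson_eval_continuous.
exists V; split=> //.
  split; last first.
    have := higson_extension_corona pX dX dY cf (conj chf hfE) Xp.
    by move=> hfp [y _ yE]; apply: hfp; exists y.
  (* The point [p] is a limit of points of [A], where [psi \o f] vanishes. *)
  pose D1 := ball (higson_eval psi (hf p)) 1.
  have nD1 : nbhs (higson_eval psi (hf p)) D1 by exact: nbhsx_ballx.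
  have nW1 : nbhs (hf p) (higson_eval psi @^-1` D1).
    by have := higson_eval_continuous nD1; rewrite !nbhs_simpl.
  have nB : nbhs p (hf @^-1` (higson_eval psi @^-1` D1)).
    by have := chf p _ nW1; rewrite !nbhs_simpl.
  have [_ [[a Aa <-]]] := Ap _ nB.
  rewrite /preimage /= hfE => /ball_sym.
  by rewrite /higson_eval /= psi0 //; exists a.
move=> q [Vq Yq].
have qfD : closure (hf @` (closure (@higson_incl R X @` D))) q.
  move=> Q nQ.
  have nV : nbhs q (Q `&` V).
    by apply: filterI => //; exact: open_nbhs_nbhs.
  have [y [Qy [y1 yB]]] := higson_incl_dense nV.
  have Ny : N y.
    apply: contrapT => nNy; apply: yB; exists y => //; split=> //.
    by move: y1; rewrite /= -ball_normE /= sub0r normrN.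
  have [d /rhoD Dd dy] := rho'f _ Ny.
  exists (higson_incl y); split=> //.
  exists (higson_incl d); last by rewrite hfE dy.
  by apply: subset_closure; exists d.
(* The image of the compact closure of [D] is closed. *)
have cK : compact (hf @` closure (@higson_incl R X @` D)).
  apply: continuous_compact; first exact: continuous_subspaceT.
  by apply: subclosed_compact (@higson_compact X) _ => //; exact: closed_closure.
have [p' Kp' p'q] := compact_closed (@higson_hausdorff R Y) cK qfD.
exists p' => //; apply: U1U; apply: closureS Kp' => _ [d Dd <-]; exact: Dd.
Qed.

End HigsonCorona.

Theorem proposition4p15 (R : realType) (X Y : metricType R) (x0 : X) (y0 : Y)
    (pX : proper_space X) (dX : discrete_space X)
    (pY : proper_space Y) (dY : discrete_space Y)
    (f : X -> Y) (cf : coarse_map f) :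
  coarsely_open x0 y0 f -> open_map (corona_map pX dX dY cf).
Proof.
move=> fo _ [U0 oU0 <-]; have hfP := higson_mapP dX cf.
rewrite openE => _ [p U0p <-].
have nU0 : nbhs (val p) U0 by exact: open_nbhs_nbhs.
have [V [oV Vp VU]] :=
  higson_extension_open pX dX pY dY cf fo hfP (set_valP p) nU0.
exists (val @^-1` V); split; [by exists V|exact: Vp|].
move=> q Vq; have [r U0r rq] := VU _ (conj Vq (set_valP q)).
(* A point of [X] would be sent into [Y], away from the corona. *)
have Xr : corona_set r.
  move=> [x _ xr]; have /= Yq := set_valP q; apply: Yq; exists (f x) => //.
  by rewrite -rq -xr; case: hfP => _ ->.
by exists (exist _ r (mem_set Xr)) => //; exact: val_inj.
Qed.
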